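(* Let $n$ be the number of vertices and let $P$ be an integer with $2 \le P \le \sqrt{n}$. Let $\mathcal{P}_{\mathrm{det}}$ be any $P$-party deterministic simultaneous message protocol for maximum bipartite matching in which every message has length at most $s$ bits. Then $\mathcal{P}_{\mathrm{det}}$ has an expected approximation factor of $\Omega\left(\left(\frac{Pn}{s}\right)^{1/4}\right)$; that is, there is a probability distribution over inputs (bipartite graphs on $\mathrm{O}(n)$ vertices whose edge sets are split into $P$ edge-disjoint subgraphs, one per party) such that $\mathbb{E}\left[\frac{|M^*|}{|N|}\right] = \Omega\left(\left(\frac{Pn}{s}\right)^{1/4}\right)$, where $M^*$ is a maximum matching of the input graph and $N$ is the matching output by the referee.
   Context: Simultaneous message (SIM) model: a bipartite graph $G=(A,B,E)$ is given, and $G_1,\dots,G_P$ are edge-disjoint subgraphs of $G$ whose union is $G$. For each $p\in[P]$, party $p$ receives only $G_p$ and sends a single message $\mu_p$ to a referee; parties cannot communicate with each other (in randomized protocols they share public random coins). Upon receiving all messages, the referee outputs a matching $N$ of $G$. Protocols never output edges not present in the input graph. In a deterministic protocol, each message $\mu_p$ is a fixed function of $G_p$. The approximation factor of an output $N$ is $|M^*|/|N|$, where $M^*$ is a maximum matching of $G$. *)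

(* Defs.v *)
From HB Require Import structures.
From mathcomp Require Import all_boot all_order all_algebra.
From mathcomp Require Import all_classical all_reals all_analysis.

Set Implicit Arguments.
Unset Strict Implicit.
Unset Printing Implicit Defensive.

Import Order.TTheory GRing.Theory Num.Theory.

Local Open Scope ring_scope.

(* A bipartite graph with classes A = 'I_a and B = 'I_b is its edge set. *)
Notation bigraph a b := {set ('I_a * 'I_b)%type}.

Definition is_matching (a b : nat) (M : bigraph a b) : bool :=
  [forall e in M, forall f in M,
     ((e.1 == f.1) || (e.2 == f.2)) ==> (e == f)].

Definition matching_of (a b : nat) (G M : bigraph a b) : bool :=
  (M \subset G) && is_matching M.

Definition max_matching (a b : nat) (G : bigraph a b) : nat :=
  (\max_(M : bigraph a b | matching_of G M) #|M|)%N.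

Definition edge_disjoint (P a b : nat)
    (Gs : {ffun 'I_P -> bigraph a b}) : bool :=
  [forall p, forall q, (p != q) ==> [disjoint Gs p & Gs q]].

Definition sim_input (P a b : nat) : finType :=
  {Gs : {ffun 'I_P -> bigraph a b} | edge_disjoint Gs}.

Definition part (P a b : nat) (G : sim_input P a b) (p : 'I_P) : bigraph a b :=
  val G p.

Definition whole (P a b : nat) (G : sim_input P a b) : bigraph a b :=
  (\bigcup_(p < P) part G p)%SET.

(* Every bipartite graph is the share of party p in some valid input (all other
   shares being empty), so [message_size] bounds only messages that do occur. *)
Record sim_protocol (P s a b : nat) := SimProtocol {
  message : 'I_P -> bigraph a b -> seq bool;
  referee : {ffun 'I_P -> seq bool} -> bigraph a b;
  message_size : forall p H, (size (message p H) <= s)%N;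
  referee_matching : forall G : sim_input P a b,
    matching_of (whole G) (referee [ffun p => message p (part G p)])
}.

Definition output (P s a b : nat) (prot : sim_protocol P s a b)
    (G : sim_input P a b) : bigraph a b :=
  referee prot [ffun p => message prot p (part G p)].

(* The ratio |M*| / |N|: it is infinite when N is empty but M* is not, and by
   convention 1 on the graph without edges. *)
Definition approx_factor (R : realType) (opt out : nat) : \bar R :=
  if out == 0%N then (if opt == 0%N then 1%E else +oo%E)
  else (opt%:R / out%:R)%:E.

Record fin_dist (R : realType) (T : finType) := FinDist {
  pmf :> T -> R;
  pmf_ge0 : forall x, 0 <= pmf x;
  pmf_sum1 : \sum_x pmf x = 1
}.

(* In \bar R, 0 * +oo = 0, so points outside the support do not contribute. *)
Definition expect (R : realType) (T : finType) (mu : fin_dist R T)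
    (f : T -> \bar R) : \bar R :=
  (\sum_x (mu x)%:E * f x)%E.

(* Main.v *)
Require Import Defs.
From HB Require Import structures.
From mathcomp Require Import all_boot all_order all_algebra.
From mathcomp Require Import all_classical all_reals all_analysis.
From mathcomp Require Import ring lra zify.
From mathcomp Require Import fintype finset fingroup perm.

Set Implicit Arguments.
Unset Strict Implicit.
Unset Printing Implicit Defensive.

(** Put [q = n / P] vertices into each of [m + P] groups per side, and choose by two
    random permutations [m] shared groups and one private group for each party on
    either side. Party [p] sees the shared groups and its private ones; any two of
    them are joined by the perfect matching [x -> x + p] mod [q], and each edge is
    kept with probability 1/2. As [P <= q], these shares are edge-disjoint. The
    private edges form a matching of expected size [P q / 2].

    An output edge of party [p]'s share must lie in every share that yields the same
    message, and a message of [s] bits certifies at most [s + 2] edges on average.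
    Since party [p] cannot tell its private groups from the shared ones, on average
    at most [(s + 2) / (m + 1) ^ 2] certified edges are private; the other output edges
    meet one of the [2 m q] shared vertices. With [alpha = (P n / s) ^ (1/4) >= 1]
    and [m = floor (P / alpha)] the output has expected size [O(n / alpha)]. *)

Import Order.TTheory GRing.Theory Num.Theory.

Local Open Scope set_scope.

(** * Elements certified by a message *)

Section Certified.
Variables (U M : finType) (f : {set U} -> M).
Implicit Types X Y : {set U}.

(** What a referee who knows only the value [f X] can be sure to find in the set. *)
Definition certified X : {set U} := \bigcap_(Y | f Y == f X) Y.

Lemma certifiedP X e :
  reflect (forall Y, f Y = f X -> e \in Y) (e \in certified X).
Proof. by apply: (iffP bigcapP) => h Y /eqP; apply: h. Qed.

Lemma eq_certified X Y : f X = f Y -> certified X = certified Y.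
Proof. by rewrite /certified => ->. Qed.

(** Removing [F] is injective on its supersets and leaves subsets of its complement. *)
Lemma card_supsets (F : {set U}) :
  #|[set X : {set U} | F \subset X]| * 2 ^ #|F| <= 2 ^ #|U|.
Proof.
rewrite -(cardsC F) addnC expnD leq_mul2r; apply/orP; right.
rewrite -card_powerset -(@card_in_imset _ _ (fun X => X :\: F) [set X : {set U} | F \subset X]).
  apply/subset_leq_card/subsetP => _ /imsetP[X _ ->].
  by rewrite inE setDE subsetIr.
move=> X Y; rewrite !inE => sX sY e.
by rewrite -(setID X F) -(setID Y F) e (setIidPr sX) (setIidPr sY).
Qed.

Lemma card_certified_class X :
  #|[set Y | f Y == f X]| * 2 ^ #|certified X| <= 2 ^ #|U|.
Proof.
apply: leq_trans (card_supsets (certified X)); rewrite leq_mul2r; apply/orP; right.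
apply/subset_leq_card/subsetP => Y; rewrite !inE => /eqP e.
by apply/subsetP => x /certifiedP; apply.
Qed.

(* A message of at most s bits certifies about s edges on average: certifying
   t edges is possible for at most a fraction 2^-t of the edge sets. *)
Lemma sum_certified s : #|M| <= 2 ^ s.+1 ->
  \sum_X #|certified X| <= s.+2 * 2 ^ #|U|.
Proof.
move=> leM; rewrite -(@leq_pmul2l (2 ^ s.+1)) ?expn_gt0//.
rewrite (partition_big f xpredT)//= big_distrr/=.
(* A class of [c] sets certifying [t] elements has [c * 2 ^ t <= 2 ^ #|U|]; so, after scaling by
   [2 ^ s.+1], the excess of [t] over [s.+1] costs at most [2 ^ #|U|] per message. *)
have cls m : 2 ^ s.+1 * (\sum_(X | f X == m) #|certified X|) <=
    2 ^ s.+1 * s.+1 * (\sum_(X | f X == m) 1) + 2 ^ #|U|.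
  case: (pickP (fun X => f X == m)) => [X0 /eqP <-|no]; last first.
    by rewrite !(big_pred0 _ _ _ _ no) muln0.
  rewrite (eq_bigr (fun=> #|certified X0|)); last by move=> X /eqP/eq_certified ->.
  rewrite sum_nat_const sum1_card.
  have -> : #|(fun X => f X == f X0)| = #|[set Y | f Y == f X0]| by rewrite cardsE.
  have := card_certified_class X0.
  move: #|[set Y | _]| #|certified X0| #|U| => c t u h.
  have [le|lt] := leqP t s.+1.
    apply: leq_trans (leq_addr _ _).
    by rewrite -mulnA leq_mul2l [c * t]mulnC leq_mul2r le !orbT.
  have -> : t = s.+1 + (t - s.+1) by rewrite subnKC// ltnW.
  rewrite mulnDr mulnDr leq_add//; first by rewrite -mulnA [c * _]mulnC.
  apply: leq_trans h; rewrite mulnCA leq_mul2l; apply/orP; right.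
  rewrite -{2}(subnKC (ltnW lt)) expnD leq_mul2l; apply/orP; right.
  by rewrite ltnW// ltn_expl.
apply: (@leq_trans (\sum_(m : M)
    (2 ^ s.+1 * s.+1 * (\sum_(X | f X == m) 1) + 2 ^ #|U|))); first exact: leq_sum.
have szU : \sum_(m : M) \sum_(X | f X == m) 1 = 2 ^ #|U|.
  transitivity (\sum_(X : {set U}) 1); first by rewrite [RHS](partition_big f xpredT).
  by rewrite sum1_card -[in RHS]cardsT -card_powerset powersetT cardsT.
rewrite big_split/= -big_distrr/= szU sum_nat_const.
have -> : 2 ^ s.+1 * (s.+2 * 2 ^ #|U|) = 2 ^ s.+1 * s.+1 * 2 ^ #|U| + 2 ^ s.+1 * 2 ^ #|U|.
  by rewrite -mulnDl -[X in _ = (_ + X) * _]muln1 -mulnDr addn1 mulnA.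
by rewrite leq_add2l leq_mul2r leM orbT.
Qed.

End Certified.

(** * Counting over subsets and encoding messages *)

Lemma sum_card_setI (U : finType) (D : {set U}) :
  2 * (\sum_(X : {set U}) #|X :&: D|) = #|D| * 2 ^ #|U|.
Proof.
(* A set and its complement together meet [D] in [#|D|] elements. *)
rewrite mul2n -addnn {2}(reindex_inj (inv_inj (@setCK U)))/= -big_split/=.
rewrite (eq_bigr (fun=> #|D|)); last first.
  by move=> X _; rewrite setIC [~: X :&: D]setIC -setDE cardsID.
by rewrite sum_nat_const -[in RHS]cardsT -card_powerset powersetT cardsT mulnC.
Qed.

(** Padding with one [true] and then with [false] up to length [s.+1] turns messages of varying
    length into elements of a finite type of size [2 ^ s.+1]. *)
Lemma bits_encoding s : exists enc : seq bool -> s.+1.-tuple bool,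
  {in [pred w | size w <= s] &, injective enc}.
Proof.
pose pad (w : seq bool) := take s.+1 (w ++ true :: nseq s false).
have szpad w : size (pad w) == s.+1.
  by rewrite size_takel// size_cat/= size_nseq addnS ltnS leq_addl.
exists (fun w => Tuple (szpad w)) => v w; rewrite !inE => sv sw /(congr1 val)/=.
have padE (u : seq bool) : size u <= s -> pad u = u ++ true :: nseq (s - size u) false.
  move=> su; rewrite /pad take_cat ltnNge leqW//= subSn//=; congr (_ ++ _ :: _).
  by rewrite take_nseq// leq_subr.
rewrite !padE//.
(* The last [true] marks the end of the message. *)
have sizeE (u : seq bool) k (x := u ++ true :: nseq k false) :
    (size x - find id (rev x)).-1 = size u.
  rewrite /x -cat_rcons rev_cat rev_nseq rev_rcons find_cat has_nseq andbF size_nseq/= addn0.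
  by rewrite size_cat size_nseq size_rcons addnK.
move=> e; have es : size v = size w by rewrite -(sizeE v (s - size v)) e sizeE.
by move/eqP: e; rewrite eqseq_cat// => /andP[/eqP].
Qed.

Lemma sum_card_setI_disjoint (U I : finType) (C : {set U}) (L : I -> {set U}) :
  (forall e i j, e \in L i -> e \in L j -> i = j) ->
  \sum_i #|C :&: L i| <= #|C|.
Proof.
move=> disL.
under eq_bigr do rewrite -sum1_card big_mkcond/=.
rewrite exchange_big/= -sum1_card [leqRHS]big_mkcond/=; apply: leq_sum => e _.
under eq_bigr do rewrite inE; case: (e \in C) => /=; last by rewrite big1.
case: (pickP (fun i => e \in L i)) => [i ei|no]; last by rewrite big1// => i _; rewrite no.
rewrite (bigD1 i)//= ei big1// => j; case: ifP => // ej.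
by rewrite (disL _ _ _ ei ej) eqxx.
Qed.

Lemma leq_card_bigcup (U I : finType) (L : I -> {set U}) :
  #|\bigcup_i L i| <= \sum_i #|L i|.
Proof.
elim/big_rec2: _ => [|i n A _ leA]; first by rewrite cards0.
by apply: leq_trans (leq_card_setU _ _) _; rewrite leq_add2l.
Qed.

(** * Matchings *)

Section MatchingFacts.
Variables a b : nat.
Implicit Types G M : bigraph a b.

Lemma matchingP M :
  reflect (forall e f, e \in M -> f \in M -> (e.1 = f.1 \/ e.2 = f.2) -> e = f)
          (is_matching M).
Proof.
apply: (iffP forall_inP) => h.
  move=> e f eM fM ef; apply/eqP.
  by have /forall_inP/(_ _ fM)/implyP := h e eM; apply; apply/orP; case: ef => ->; [left|right].
move=> e eM; apply/forall_inP => f fM; apply/implyP => /orP ef.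
by apply/eqP/h => //; case: ef => /eqP; [left|right].
Qed.

Lemma leq_max_matching G M : matching_of G M -> #|M| <= max_matching G.
Proof. by move=> h; rewrite /max_matching (bigD1 M)//= leq_maxl. Qed.

End MatchingFacts.

(** * The hard distribution *)

Section HardDistribution.
Variables (P m q a : nat).

Notation group := ('I_m + 'I_P)%type.
(** On either side [vx] places a position of a group among the vertices. The shift of party [p] is
    [sh p]; [shPI] keeps links of different parties disjoint. *)
Variables (vx : group * 'I_q -> 'I_a) (sh : 'I_P -> 'I_q -> 'I_q).
Hypotheses (vxI : injective vx) (shI : forall p, injective (sh p)).
Hypothesis shPI : forall x, injective (sh^~ x).

Notation graph := (bigraph a a).
Notation perms := ({perm group} * {perm group})%type.
Implicit Types (p : 'I_P) (i j : group) (g : perms) (w : perms * graph).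

Definition link p i j : graph := [set (vx (i, x), vx (j, sh p x)) | x : 'I_q].

Lemma link_disjoint p p' i i' j j' e :
  e \in link p i j -> e \in link p' i' j' -> [/\ p = p', i = i' & j = j'].
Proof.
case/imsetP => x _ -> /imsetP[y _ []] /vxI[-> <-] /vxI[-> /shPI ->].
by [].
Qed.

Lemma card_link p i j : #|link p i j| = q.
Proof. by rewrite card_imset ?card_ord// => x y [] /vxI[]. Qed.

Definition slot p (o : option 'I_m) : group := if o is Some i then inl i else inr p.

Lemma slot_inj p : injective (slot p).
Proof. by case=> [i|] [j|]//= [->]. Qed.

Definition base g p : graph :=
  \bigcup_(o : option 'I_m * option 'I_m) link p (g.1 (slot p o.1)) (g.2 (slot p o.2)).

Lemma base_disjoint g p p' e : e \in base g p -> e \in base g p' -> p = p'.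
Proof. by case/bigcupP => o _ eo /bigcupP[r _ eo']; case: (link_disjoint eo eo'). Qed.

Lemma share_disjoint w : edge_disjoint [ffun p => w.2 :&: base w.1 p].
Proof.
apply/forallP => p; apply/forallP => p'; apply/implyP => pp'; rewrite !ffunE.
rewrite -setI_eq0; apply/eqP/setP => e; rewrite !inE; apply/negP.
by move=> /andP[/andP[_ ep] /andP[_ ep']]; rewrite (base_disjoint ep ep') eqxx in pp'.
Qed.

Definition instance w : sim_input P a a := Sub _ (share_disjoint w).

Lemma part_instance w p : part (instance w) p = w.2 :&: base w.1 p.
Proof. by rewrite /part/= ffunE. Qed.

Definition private g p : graph := link p (g.1 (inr p)) (g.2 (inr p)).

Lemma private_sub g p : private g p \subset base g p.
Proof. exact: (bigcup_sup (None, None)). Qed.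

Definition privates g : graph := \bigcup_p private g p.

(** Permutations give different parties different private groups, and each link is itself a
    matching. *)
Lemma private_matching w : matching_of (whole (instance w)) (w.2 :&: privates w.1).
Proof.
apply/andP; split.
  apply/subsetP => e; rewrite inE => /andP[eX /bigcupP[p _ ep]]; apply/bigcupP; exists p => //.
  by rewrite part_instance inE eX (subsetP (private_sub _ _)).
apply/matchingP => e f; rewrite !inE => /andP[_ /bigcupP[p _ /imsetP[x _ ->]]].
move=> /andP[_ /bigcupP[p' _ /imsetP[y _ ->]]] /=.
case=> /vxI [] /perm_inj[pp']; first by move=> ->; rewrite pp'.
by rewrite pp' => /shI ->.
Qed.

Lemma card_privates g : #|privates g| = P * q.
Proof.
have sumE : \sum_p #|private g p| = P * q.
  by under eq_bigr do rewrite card_link; rewrite sum_nat_const card_ord.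
apply/eqP; rewrite eqn_leq -sumE leq_card_bigcup/=.
have := @sum_card_setI_disjoint _ _ (privates g) (private g).
under eq_bigr => p _ do rewrite (setIidPr (bigcup_sup p isT)).
by apply=> e p p' /link_disjoint ep /ep[].
Qed.

Definition shared (t : {perm group}) : {set 'I_a} :=
  [set vx (t (inl u.1), u.2) | u : 'I_m * 'I_q].

Lemma card_shared t : #|shared t| <= m * q.
Proof. by apply: leq_trans (leq_imset_card _ _) _; rewrite card_prod !card_ord. Qed.

(** Output edges outside the private links have an end in a shared group, and a matching uses each
    shared vertex at most once. *)
Lemma card_matching_instance w (N : graph) : matching_of (whole (instance w)) N ->
  #|N| <= 2 * (m * q) + \sum_p #|N :&: private w.1 p|.
Proof.
move=> /andP[/subsetP subN /matchingP matN].
have fst_le (h : 'I_a * 'I_a -> 'I_a) (S : {set 'I_a}) : {in N &, injective h} ->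
    #|[set e in N | h e \in S]| <= #|S|.
  move=> hI; rewrite -(@card_in_imset _ _ h); last first.
    by move=> e f; rewrite !inE => /andP[eN _] /andP[fN _]; apply: hI.
  by apply/subset_leq_card/subsetP => _ /imsetP[e + ->]; rewrite inE => /andP[].
have sub : N \subset [set e in N | e.1 \in shared w.1.1] :|:
    [set e in N | e.2 \in shared w.1.2] :|: \bigcup_p (N :&: private w.1 p).
  apply/subsetP => e eN; have /bigcupP[p _] := subN e eN.
  rewrite part_instance inE => /andP[_ /bigcupP[[r r'] _ /=]] el; rewrite !inE eN/=.
  case: r r' el => [i|] [j|] el.
  - case/imsetP: el => x _ -> /=; apply/orP; left; apply/orP; left.
    by apply/imsetP; exists (i, x).
  - case/imsetP: el => x _ -> /=; apply/orP; left; apply/orP; left.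
    by apply/imsetP; exists (i, x).
  - case/imsetP: el => x _ -> /=; apply/orP; left; apply/orP; right.
    by apply/imsetP; exists (j, sh p x).
  - by apply/orP; right; apply/bigcupP; exists p => //; rewrite inE eN.
apply: leq_trans (subset_leq_card sub) _.
apply: leq_trans (leq_card_setU _ _) _; apply: leq_add.
  apply: leq_trans (leq_card_setU _ _) _; rewrite mul2n -addnn; apply: leq_add.
    apply: leq_trans (fst_le fst _ _) (card_shared _).
    by move=> e f eN fN ef; apply: matN => //; left.
  apply: leq_trans (fst_le snd _ _) (card_shared _).
  by move=> e f eN fN ef; apply: matN => //; right.
exact: leq_card_bigcup.
Qed.

(** * Hiding the private groups *)

Definition swap p o : {perm group} := tperm (slot p o) (inr p).

Definition swaps p (o : option 'I_m * option 'I_m) g : perms :=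
  ((swap p o.1 * g.1)%g, (swap p o.2 * g.2)%g).

Lemma swapsK p o : involutive (swaps p o).
Proof. by case=> g1 g2; rewrite /swaps /= !mulgA /swap !tperm2 !mul1g. Qed.

Lemma swap_slot p o o' : exists o'', swap p o (slot p o') = slot p o''.
Proof.
rewrite /swap; case: tpermP => _; [by exists None|by exists o|by exists o'].
Qed.

(** A swap only permutes the slots of [p], so it re-indexes the union. *)
Lemma base_swaps p o g : base (swaps p o g) p = base g p.
Proof.
have sub h : base (swaps p o h) p \subset base h p.
  apply/bigcupsP => -[r1 r2] _ /=; rewrite !permM.
  have [r1' ->] := swap_slot p o.1 r1; have [r2' ->] := swap_slot p o.2 r2.
  exact: (bigcup_sup (r1', r2')).
by apply/eqP; rewrite eqEsubset sub -{1}(swapsK p o g) sub.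
Qed.

(* Party p cannot tell which of the groups it sees are its private ones: the
   swaps permute them transitively without changing its share. *)
Lemma sum_private_hidden p (C : graph -> {set 'I_a * 'I_a}) :
  m.+1 ^ 2 * (\sum_g #|C (base g p) :&: private g p|) <= \sum_g #|C (base g p)|.
Proof.
(* The swap turns the private link into the link at slots [o], so all [m.+1 ^ 2] disjoint links
   contribute equally. *)
have reidx o : \sum_g #|C (base g p) :&: private g p| =
    \sum_g #|C (base g p) :&: link p (g.1 (slot p o.1)) (g.2 (slot p o.2))|.
  rewrite (reindex_inj (inv_inj (swapsK p o))); apply: eq_bigr => g _.
  by rewrite base_swaps /private /= !permM /swap !tpermR.
have -> : m.+1 ^ 2 = #|{: option 'I_m * option 'I_m}|.
  by rewrite card_prod card_option card_ord mulnn.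
rewrite -sum_nat_const (eq_bigr _ (fun o _ => reidx o)) exchange_big/=.
apply: leq_sum => g _; apply: sum_card_setI_disjoint => e [r1 r2] [r1' r2'].
by move=> /link_disjoint ep /ep[_ /perm_inj/slot_inj/= -> /perm_inj/slot_inj/= ->].
Qed.

(** * Expected size of the output *)

Section Protocol.
Variables (s : nat) (prot : sim_protocol P s a a) (enc : seq bool -> s.+1.-tuple bool).
Hypothesis encI : {in [pred u | size u <= s] &, injective enc}.

Definition view p (H X : graph) := enc (message prot p (X :&: H)).

(* Replacing the share of party p by another one with the same message keeps
   the output, so each of its edges must occur in the new share as well. *)
Lemma output_certified w p e :
  e \in output prot (instance w) -> e \in base w.1 p ->
  e \in certified (view p (base w.1 p)) w.2.
Proof.
move=> eN ep; apply/certifiedP => Y /encI eY.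
(* Bases of different parties are disjoint, so all other shares stay as they are. *)
pose X := (w.2 :\: base w.1 p) :|: (Y :&: base w.1 p).
have same : output prot (instance (w.1, X)) = output prot (instance w).
  rewrite /output; congr referee; apply/ffunP => p'; rewrite !ffunE !part_instance/=.
  have [->|pp'] := eqVneq p' p.
    rewrite -eY ?inE ?message_size//; congr message; apply/setP => f; rewrite !inE.
    by case: (f \in base w.1 p); rewrite /= ?andbF ?andbT ?orbF.
  congr message; apply/setP => f; rewrite !inE.
  have [fp'|_] := boolP (f \in base w.1 p'); last by rewrite !andbF.
  rewrite !andbT; have -> : f \in base w.1 p = false; last by rewrite andbF orbF.
  by apply/negP => fp; rewrite (base_disjoint fp fp') eqxx in pp'.
have /andP[/subsetP sub _] := referee_matching prot (instance (w.1, X)).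
have := sub e; rewrite -/(output _ _) same => /(_ eN)/bigcupP[p' _].
rewrite part_instance/= inE => /andP[+ _]; rewrite !inE ep.
by rewrite andbT.
Qed.

Let total := #|{: perms}| * 2 ^ #|{: 'I_a * 'I_a}|.

Lemma sum_output : m.+1 ^ 2 * (\sum_w #|output prot (instance w)|) <=
  total * (m.+1 ^ 2 * (2 * (m * q)) + P * s.+2).
Proof.
have bound w : #|output prot (instance w)| <=
    2 * (m * q) + \sum_p #|certified (view p (base w.1 p)) w.2 :&: private w.1 p|.
  apply: leq_trans (card_matching_instance (referee_matching _ _)) _.
  rewrite leq_add2l; apply: leq_sum => p _; apply/subset_leq_card/subsetP => e.
  rewrite !inE => /andP[eN ep]; rewrite ep andbT.
  by apply: output_certified => //; apply: (subsetP (private_sub _ _)).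
have cardw : #|{: perms * graph}| = total.
  by rewrite card_prod -[#|{set _}|]cardsT -powersetT card_powerset cardsT.
apply: (@leq_trans (m.+1 ^ 2 * (\sum_w (2 * (m * q) +
    \sum_p #|certified (view p (base w.1 p)) w.2 :&: private w.1 p|)))).
  by rewrite leq_mul2l; apply/orP; right; apply: leq_sum => w _; apply: bound.
rewrite big_split/= sum_nat_const cardw mulnDr [leqRHS]mulnDr [X in _ <= X + _]mulnCA leq_add2l.
rewrite exchange_big/= big_distrr/= mulnCA -[X in X * (total * _)]card_ord -sum_nat_const.
apply: leq_sum => p _.
rewrite -(pair_bigA _ (fun g X => #|certified (view p (base g p)) X :&: private g p|))/=.
rewrite exchange_big/= big_distrr/=.
(* Hiding is applied for each fixed edge set [X], then the bound on certified edges for each fixed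
   [g]. *)
apply: (@leq_trans (\sum_(X : graph) \sum_g #|certified (view p (base g p)) X|)).
  apply: leq_sum => X _.
  exact: (sum_private_hidden p (fun H => certified (view p H) X)).
rewrite exchange_big/= /total -mulnA -sum_nat_const; apply: leq_sum => g _.
by rewrite mulnC; apply: sum_certified; rewrite card_tuple card_bool.
Qed.

End Protocol.

Lemma sum_private : 2 * (\sum_w #|w.2 :&: privates w.1|) =
  #|{: perms}| * 2 ^ #|{: 'I_a * 'I_a}| * (P * q).
Proof.
rewrite -(pair_bigA _ (fun g (X : graph) => #|X :&: privates g|))/= big_distrr/=.
under eq_bigr do rewrite sum_card_setI card_privates.
by rewrite sum_nat_const mulnA mulnAC.
Qed.

End HardDistribution.

Local Open Scope ring_scope.

(** * Expectations and the approximation factor *)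

Section Expectation.
Variables (R : realType) (T : finType).

Lemma uniform_image_dist (W : finType) (h : W -> T) : (0 < #|W|)%N ->
  exists mu : fin_dist R T, forall f : T -> R,
    \sum_x mu x * f x = (\sum_w f (h w)) / #|W|%:R.
Proof.
move=> W0; pose pm x : R := \sum_(w | h w == x) (#|W|%:R)^-1.
have pmE f : \sum_x pm x * f x = (\sum_w f (h w)) / #|W|%:R.
  rewrite (partition_big h xpredT)//= mulr_suml; apply: eq_bigr => x _.
  rewrite !mulr_suml; apply: eq_bigr => w /eqP <-.
  by rewrite mulrC.
have pm0 x : 0 <= pm x by apply: sumr_ge0 => w _; rewrite invr_ge0 ler0n.
have pm1 : \sum_x pm x = 1.
  transitivity (\sum_x pm x * 1); first by apply: eq_bigr => x _; rewrite mulr1.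
  by rewrite pmE sumr_const mulfV// pnatr_eq0 -lt0n.
by exists (FinDist pm0 pm1).
Qed.

Lemma expect_ge_sum (mu : fin_dist R T) (f : T -> \bar R) (g : T -> R) :
  (forall x, ((g x)%:E <= f x)%E) -> ((\sum_x mu x * g x)%:E <= expect mu f)%E.
Proof.
move=> gf; rewrite /expect -sumEFin; apply: lee_sum => x _.
by rewrite EFinM lee_wpmul2l// lee_fin Defs.pmf_ge0.
Qed.

Lemma expect_ge1 (mu : fin_dist R T) (f : T -> \bar R) :
  (forall x, (1 <= f x)%E) -> (1 <= expect mu f)%E.
Proof.
move=> f1; apply: le_trans (expect_ge_sum mu (g := fun=> 1) f1).
by rewrite -mulr_suml Defs.pmf_sum1 mulr1.
Qed.

End Expectation.

Lemma approx_factor_ge1 (R : realType) (opt out : nat) : (out <= opt)%N ->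
  (1 <= approx_factor R opt out)%E.
Proof.
rewrite /approx_factor; case: eqP => [_ _|/eqP out0 le].
  by case: eqP => // _; rewrite leey.
by rewrite lee_fin ler_pdivlMr ?ltr0n ?lt0n// mul1r ler_nat.
Qed.

(* [2 / b - x / b ^+ 2] is the tangent at [b] of the convex function [1 / x]. *)
Lemma approx_factor_tangent (R : realType) (opt out z : nat) (b : R) : 0 < b ->
  (((minn opt z)%:R * (2 / b - out%:R / b ^+ 2))%:E <= approx_factor R opt out)%E.
Proof.
move=> b0; rewrite /approx_factor; case: eqP => [->|/eqP out0].
  (* With empty output, the factor is infinite or [opt = 0] makes the lower bound vanish. *)
  by case: eqP => [->|_]; rewrite ?leey// min0n mul0r lee_fin.
have N0 : 0 < out%:R :> R by rewrite ltr0n lt0n.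
rewrite lee_fin; apply: (@le_trans _ _ ((minn opt z)%:R / out%:R)).
  apply: ler_wpM2l => //; rewrite -subr_ge0.
  have -> : out%:R^-1 - (2 / b - out%:R / b ^+ 2) = (1 - out%:R / b) ^+ 2 / out%:R.
    by field; rewrite !gt_eqF.
  by rewrite divr_ge0 ?sqr_ge0// ltW.
by rewrite ler_pM2r ?invr_gt0// ler_nat geq_minl.
Qed.

Lemma distinct_shifts P q : (0 < q)%N -> (P <= q)%N ->
  exists sh : 'I_P -> 'I_q -> 'I_q,
    (forall p, injective (sh p)) /\ (forall x, injective (sh^~ x)).
Proof.
case: q => // q _ Pq; exists (fun p x => inord p + x); split=> [p x y /addrI//|x p p' /addIr].
move/(congr1 val); rewrite /= !inordK; first exact: val_inj.
all: exact: leq_trans (ltn_ord _) Pq.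
Qed.

(** * The lower bound for given [m] and [q] *)

Lemma hard_distribution (R : realType) (P m q a s : nat) :
  (0 < P)%N -> (P <= q)%N -> ((m + P) * q <= a)%N ->
  exists mu : fin_dist R (sim_input P a a), forall prot : sim_protocol P s a a,
    (((P * q)%:R / (4 * ((2 * (m * q))%:R + (P * s.+2)%:R / (m.+1 ^ 2)%:R)))%:E <=
      expect mu (fun G => approx_factor R (max_matching (whole G)) #|output prot G|))%E.
Proof.
move=> P0 Pq le_a.
have q0 := leq_trans P0 Pq.
have [sh [shI shPI]] := distinct_shifts q0 Pq.
have le_card : (#|{: ('I_m + 'I_P) * 'I_q}| <= a)%N.
  by rewrite card_prod card_sum !card_ord.
pose vx u := widen_ord le_card (enum_rank u).
have vxI : injective vx by move=> u v /(congr1 val)/= /val_inj/enum_rank_inj.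
pose perms := ({perm 'I_m + 'I_P} * {perm 'I_m + 'I_P})%type.
pose W := (perms * bigraph a a)%type.
pose inst : W -> _ := instance vxI shPI.
have W0 : (0 < #|{: W}|)%N.
  by apply/card_gt0P; exists ((1%g, 1%g), set0).
have cardW : #|{: W}| = (#|{: perms}| * 2 ^ #|{: 'I_a * 'I_a}|)%N.
  by rewrite card_prod -[#|{set _}|]cardsT -powersetT card_powerset cardsT.
have [mu muE] := uniform_image_dist R inst W0.
exists mu => prot.
have [k2 k2E] : exists k2, k2 = (m.+1 ^ 2)%N by eexists.
have k20 : (0 < k2)%N by rewrite k2E expn_gt0.
rewrite -k2E; set b0 := _ + _ / _.
have b00 : 0 < b0.
  by rewrite ltr_wpDl// divr_gt0// ltr0n ?muln_gt0 ?P0.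
have b0' : 0 < 2 * b0 by rewrite mulr_gt0.
(* The tangent is taken at twice the bound [b0] on the expected output. Capping the optimum at
   [P * q] controls its product with the output size without any independence. *)
apply: le_trans (expect_ge_sum mu (fun G => approx_factor_tangent _ _ (P * q) b0')).
rewrite lee_fin muE ler_pdivlMr ?ltr0n//.
under eq_bigr do rewrite mulrBr.
rewrite sumrB.
have [enc encI] := bits_encoding s.
have out_le : \sum_w (#|output prot (inst w)|)%:R <= #|{: W}|%:R * b0.
  have := sum_output vxI shPI prot encI.
  rewrite -k2E -cardW -(ler_nat R) !natrM natrD !natrM natr_sum => h.
  rewrite -(@ler_pM2l _ (k2%:R : R)) ?ltr0n//.
  apply: le_trans h _; rewrite [leRHS]mulrCA ler_wpM2l// /b0 [leRHS]mulrDr !natrM lerD//.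
  by rewrite mulrCA mulfV ?mulr1// pnatr_eq0 -lt0n.
have opt_ge : #|{: W}|%:R * (P * q)%:R <=
    2 * \sum_w (minn (max_matching (whole (inst w))) (P * q))%:R :> R.
  rewrite -natr_sum -!natrM ler_nat cardW -(sum_private vxI shPI) leq_mul2l/=.
  apply: leq_sum => w _; rewrite leq_min leq_max_matching ?private_matching//=.
  rewrite -(card_privates vxI shPI w.1); exact: subset_leq_card (subsetIr _ _).
rewrite -!mulr_suml.
have minN_le : \sum_w (minn (max_matching (whole (inst w))) (P * q))%:R *
    (#|output prot (inst w)|%:R / (2 * b0) ^+ 2) <=
    (P * q)%:R * (#|{: W}|%:R * b0 / (2 * b0) ^+ 2).
  apply: (@le_trans _ _ (\sum_w (P * q)%:R * (#|output prot (inst w)|%:R / (2 * b0) ^+ 2))).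
    apply: ler_sum => w _; apply: ler_wpM2r; first by rewrite divr_ge0// sqr_ge0.
    by rewrite ler_nat geq_minr.
  rewrite -mulr_sumr -mulr_suml ler_wpM2l// ler_wpM2r// invr_ge0 sqr_ge0//.
set A := \sum_w _ in opt_ge *; set B := \sum_w _ in minN_le *.
move: A B minN_le opt_ge => A B minN_le opt_ge.
have b0N : b0 != 0 by rewrite gt_eqF.
move: minN_le; set w : R := #|_|%:R in opt_ge *; set z : R := (P * q)%:R in opt_ge * => minN_le.
(* Per input this is [z / (2 * b0) - z / (4 * b0)]. *)
have -> : z / (4 * b0) * w = w * z / 2 / b0 - z * (w * b0 / (2 * b0) ^+ 2) by field.
rewrite lerB//; have -> : A * (2 / (2 * b0)) = A / b0 by field.
by rewrite ler_pM2r ?invr_gt0// ler_pdivrMr// mulrC [A * 2]mulrC mulrC.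
Qed.

(** * Choice of the parameters *)

Theorem theorem1 (R : realType) :
  exists (c : R) (C : nat), 0 < c /\
    forall n P s : nat,
      (2 <= P)%N -> (P%:R : R) <= Num.sqrt n%:R -> (0 < s)%N ->
      exists mu : fin_dist R (sim_input P (C * n) (C * n)),
        forall prot : sim_protocol P s (C * n) (C * n),
          ((c * (P%:R * n%:R / s%:R) `^ (1 / 4))%:E <=
             expect mu (fun G => approx_factor R (max_matching (whole G))
                                               #|output prot G|))%E.
Proof.
(* As [m <= P], the groups fit into [2 * n] vertices per side; [1 / 40] comes from [P * q >= n / 2]
   and [b0 <= 5 * n / A]. *)
exists (1 / 40), 2%N; split=> [|n P s P2 Psqrt s0]; first by rewrite divr_gt0.
have P0 : (0 < P)%N by apply: leq_trans P2.
have PPn : (P * P <= n)%N.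
  rewrite -(ler_nat R) natrM -expr2 -[leRHS]sqr_sqrtr ?ler0n//.
  by rewrite lerXn2r ?nnegrE ?sqrtr_ge0 ?ler0n.
have n0 : (0 < n)%N by apply: leq_trans PPn; rewrite muln_gt0 P0.
pose q := (n %/ P)%N.
have Pq : (P <= q)%N by rewrite leq_divRL.
have q0 : (0 < q)%N by apply: leq_trans Pq.
have Pqn : (P * q <= n)%N by rewrite mulnC leq_divM.
have n2Pq : (n <= 2 * (P * q))%N.
  have := ltn_ceil n P0; rewrite -/q mulnC mulnS => /ltnW/leq_trans; apply.
  by rewrite mul2n -addnn leq_add2r leq_pmulr.
set A := _ `^ _.
have A0 : 0 < A by rewrite powR_gt0 ?divr_gt0 ?mulr_gt0 ?ltr0n.
have A4 : A ^+ 4 = P%:R * n%:R / s%:R.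
  by rewrite -powR_mulrn ?ltW// -powRrM divfK// powRr1// divr_ge0// mulr_ge0.
(* If [A < 1], any distribution will do, since the factor is at least 1; [m = 0] supplies one. *)
have [A1|A1] := leP 1 A; last first.
  have [|mu _] := @hard_distribution R P 0 q (2 * n) s P0 Pq.
    by apply: leq_trans Pqn _; rewrite leq_pmull.
  exists mu => prot; apply: le_trans (expect_ge1 mu _) => [|G].
    rewrite lee_fin; lra.
  apply: approx_factor_ge1; apply: leq_max_matching; exact: referee_matching.
pose m := Num.truncn (P%:R / A).
have /andP[mle ltm] : m%:R <= P%:R / A < m.+1%:R.
  by apply: truncn_itv; rewrite divr_ge0// ltW.
have mP : (m <= P)%N.
  by rewrite -(ler_nat R); apply: le_trans mle _; rewrite ler_pdivrMr// ler_peMr.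
have le2n : ((m + P) * q <= 2 * n)%N.
  rewrite mulnDl mul2n -addnn leq_add//; apply: leq_trans Pqn; by rewrite leq_mul2r mP orbT.
have [mu hmu] := hard_distribution R s P0 Pq le2n.
exists mu => prot; apply: le_trans (hmu prot); rewrite lee_fin.
set b0 := _ + _ / _.
have nR0 : 0 < n%:R :> R by rewrite ltr0n.
have PR0 : 0 < P%:R :> R by rewrite ltr0n.
have sR0 : 0 < s%:R :> R by rewrite ltr0n.
have b00 : 0 < b0.
  by rewrite ltr_wpDl// divr_gt0// ltr0n ?expn_gt0// muln_gt0 P0.
(* The shared term uses [m <= P / A]. The other uses [m.+1 > P / A], [s.+2 <= 3 * s] and
   [s * A ^+ 4 = P * n], giving [3 * n / A ^+ 2]. *)
have b0le : b0 <= 5 * n%:R / A.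
  have -> : 5 * n%:R / A = 2 * n%:R / A + 3 * n%:R / A by field; rewrite gt_eqF.
  rewrite lerD//.
    rewrite ler_pdivlMr// natrM -mulrA ler_pM2l// natrM.
    apply: (@le_trans _ _ (P%:R * q%:R)); last by rewrite -natrM ler_nat.
    by rewrite mulrAC ler_wpM2r// -ler_pdivlMr.
  apply: (@le_trans _ _ ((P * s.+2)%:R / (P%:R / A) ^+ 2)).
    rewrite ler_wpM2l// lef_pV2 ?posrE ?exprn_gt0 ?divr_gt0 ?ltr0n ?expn_gt0//.
    by rewrite natrX lerXn2r ?nnegrE ?divr_ge0// ltW.
  have -> : (P * s.+2)%:R / (P%:R / A) ^+ 2 = s.+2%:R * A ^+ 2 / P%:R.
    by rewrite natrM; field; rewrite !gt_eqF.
  apply: (@le_trans _ _ (3 * s%:R * A ^+ 2 / P%:R)).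
    by rewrite ler_pM2r ?invr_gt0// ler_pM2r ?exprn_gt0// -natrM ler_nat; lia.
  have sE : s%:R * A ^+ 4 = P%:R * n%:R by rewrite A4 mulrC divfK// gt_eqF.
  have -> : 3 * s%:R * A ^+ 2 / P%:R = 3 * n%:R / A ^+ 2.
    have -> : n%:R = s%:R * A ^+ 4 / P%:R by rewrite sE mulrC mulKf// gt_eqF.
    by field; rewrite !gt_eqF.
  by rewrite ler_pM2l ?mulr_gt0// lef_pV2 ?posrE ?exprn_gt0// expr2 ler_peMr ?(ltW A0).
apply: (@le_trans _ _ (n%:R / 2 / (4 * (5 * n%:R / A)))).
  rewrite le_eqVlt; apply/orP; left; apply/eqP; field; rewrite !gt_eqF//.
apply: ler_pM => //.
- by rewrite invr_ge0 mulr_ge0// divr_ge0 ?mulr_ge0 // ltW.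
- by rewrite ler_pdivrMr// -natrM ler_nat mulnC.
- have d0 : 0 < 5 * n%:R / A by rewrite divr_gt0 ?mulr_gt0.
  by rewrite lef_pV2 ?ler_pM2l// posrE mulr_gt0.
Qed.
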